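(* Every simple automorphic $2$-loop is commutative and has exponent $2$ (i.e. $x^2=1$ for all $x$).
   Context: A loop is a set with a binary operation in which left and right division are uniquely solvable and which has a neutral element $1$. $\mathrm{Mlt}(Q)$ is the group generated by all left and right translations, $\mathrm{Inn}(Q)$ the stabilizer of $1$ in it; $Q$ is automorphic if $\mathrm{Inn}(Q)\le\mathrm{Aut}(Q)$ (automorphic loops are power-associative). A $2$-loop is a finite loop of order $2^m$, $m\ge 1$. A loop is simple if its only normal subloops (kernels of homomorphisms) are $1$ and itself. *)

(* Defs.v *)
From mathcomp Require Import all_boot all_fingroup.
Set Implicit Arguments. Unset Strict Implicit. Unset Printing Implicit Defensive.

Definition is_loop (T : Type) (op : T -> T -> T) (e : T) : Prop :=
  (forall x, op e x = x) /\ (forall x, op x e = x) /\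
  (forall a b, exists! x, op a x = b) /\
  (forall a b, exists! y, op y a = b).

Definition two_loop (T : finType) (op : T -> T -> T) (e : T) : Prop :=
  is_loop op e /\ exists m, 0 < m /\ #|T| = 2 ^ m.

Section Mlt.
Variables (T : finType) (op : T -> T -> T) (e : T).

Definition left_transl : {set {perm T}} :=
  [set p : {perm T} | [exists a, [forall x, p x == op a x]]].
Definition right_transl : {set {perm T}} :=
  [set p : {perm T} | [exists a, [forall x, p x == op x a]]].

Definition Mlt : {set {perm T}} := <<left_transl :|: right_transl>>%g.
Definition Inn : {set {perm T}} := [set p in Mlt | p e == e].
End Mlt.

Definition automorphic (T : finType) (op : T -> T -> T) (e : T) : Prop :=
  forall p, p \in Inn op e -> forall x y, p (op x y) = op (p x) (p y).

Definition loop_hom (T T' : Type) (op : T -> T -> T) (op' : T' -> T' -> T')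
  (f : T -> T') : Prop := forall x y, f (op x y) = op' (f x) (f y).

(* simple: every normal subloop (kernel of a homomorphism into a loop)
   is trivial or the whole loop *)
Definition simple_loop (T : Type) (op : T -> T -> T) (e : T) : Prop :=
  forall (T' : Type) (op' : T' -> T' -> T') (e' : T') (f : T -> T'),
    is_loop op' e' -> loop_hom op op' f ->
    (forall x, f x = e') \/ (forall x, f x = e' -> x = e).

(* Main.v *)
Require Import Defs.
From mathcomp Require Import all_boot all_fingroup all_solvable.
Set Implicit Arguments. Unset Strict Implicit. Unset Printing Implicit Defensive.

(** Inversion [J] of an automorphic loop commutes with every inner mapping,
since these are automorphisms.  Applying this to two well-chosen inner mappings
gives [(u v)^-1 = v^-1 u^-1], so [J] swaps left and right translations and
normalizes [Mlt].  As [J] centralizes [Inn], the conjugates [J^g] with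
[g] in [Mlt] depend only on [g 1], and the equivalence "same conjugate" on [Q]
is a congruence.  By simplicity either [J] centralizes [Mlt], or its centralizer
in [Mlt] is [Inn] and its class has [|Q| = 2^m] elements.  An involution whose
class has 2-power size lies in the 2-core [N] of the group [Mlt <J>]; then
[Mlt] meets the center of [N] in a normal subgroup of [Mlt] contained in [Inn],
which is trivial, so that [Mlt] meets [N] trivially and [J] centralizes [Mlt]
again.  Finally, [J] commuting with the translation by [x] gives [x^-1 = x], and
then [(u v)^-1 = v^-1 u^-1] is commutativity. *)

Local Open Scope group_scope.

(** * Conjugacy classes of prime power size *)

Section PrimePowerClass.
Variables (gT : finGroupType) (p : nat).
Implicit Types (G M : {group gT}) (x : gT).

(** If [P] is a Sylow subgroup containing [x], counting orders gives ['C_G[x] * P = G]. Hence all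
    conjugates of [x] are conjugates under [P], and they generate a normal [p]-subgroup. *)
Lemma prime_power_class_pcore G x : prime p ->
  x \in G -> p.-elt x -> p.-nat #|x ^: G| -> x \in 'O_p(G).
Proof.
move=> p_pr Gx px pcl.
have sxG : <[x]> \subset G by rewrite cycle_subG.
have [P sylP sxP] := Sylow_superset sxG px.
have [sPG pP _] := and3P sylP.
have CG : 'C_G[x] * P = G.
  apply/eqP; rewrite eqEcard mul_subG ?subsetIl //=.
  rewrite -(@leq_pmul2r #|'C_G[x] :&: P|) ?cardG_gt0 // -mul_cardG.
  have iC : p.-nat #|G : 'C_G[x]| by rewrite index_cent1.
  have C0 : #|G| = (#|'C_G[x]| * #|G : 'C_G[x]|)%N by rewrite Lagrange ?subsetIl.
  rewrite [X in (X * _ <= _)%N]C0 -mulnA leq_pmul2l ?cardG_gt0 //.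
  apply: dvdn_leq; rewrite ?cardG_gt0 //.
  rewrite (card_Hall sylP) C0 partnM ?cardG_gt0 // (part_pnat_id iC) mulnC.
  rewrite dvdn_pmul2r ?indexg_gt0 //.
  have pI : p.-nat #|'C_G[x] :&: P| by apply: pnat_dvd pP; rewrite cardSg ?subsetIr.
  by rewrite -(part_pnat_id pI) partn_dvd ?cardG_gt0 // cardSg ?subsetIl.
have sclP : x ^: G \subset P.
  apply/subsetP=> _ /imsetP[g Gg ->].
  move: Gg; rewrite -CG => /mulsgP[c q /setIP[_ /cent1P cx] Pq ->].
  rewrite conjgM (_ : x ^ c = x) ?groupJ //; last by rewrite conjgE -cx mulKg.
  by rewrite -cycle_subG.
have: <<x ^: G>> \subset 'O_p(G).
  apply: pcore_max; first by apply: pgroupS pP; rewrite gen_subG.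
  rewrite /normal gen_subG class_subG ?norms_gen ?class_norm //.
by move/subsetP; apply; rewrite mem_gen ?class_refl.
Qed.

Lemma prime_power_class_cent M x : prime p ->
    x \in 'N(M) -> p.-elt x -> p.-nat #|x ^: M| ->
    (forall H : {group gT}, H <| M -> H \subset 'C[x] -> H :=: 1) ->
  M \subset 'C[x].
Proof.
move=> p_pr nMx px pcl core1.
pose G := (M <*> <[x]>)%G.
have nM : <[x]> \subset 'N(M) by rewrite cycle_subG.
have GE : G :=: <[x]> * M by rewrite /= norm_joinEr // normC.
have Gx : x \in G by rewrite -cycle_subG joing_subr.
have sMG : M \subset G by rewrite joing_subl.
have nsMG : M <| G by rewrite /normal sMG join_subG normG.
have clG : x ^: G = x ^: M.
  apply/eqP; rewrite eqEsubset andbC imsetS //=.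
  apply/subsetP=> _ /imsetP[g Gg ->].
  move: Gg; rewrite GE => /mulsgP[_ m /cycleP[i ->] Mm ->].
  by rewrite conjgM (conjgE x) (commuteX i (commute_refl x)) mulKg imset_f.
have Ox : x \in 'O_p(G) by apply: prime_power_class_pcore; rewrite ?clG.
have nsZ : 'Z('O_p(G)) <| G.
  exact: gFnormal_trans (pcore_normal _ _).
have MZ1 : M :&: 'Z('O_p(G)) = 1.
  apply: (core1 (M :&: 'Z('O_p(G)))%G).
    exact: normalS (subsetIl _ _) sMG (normalI nsMG nsZ).
  apply: subset_trans (subsetIr _ _) _; rewrite sub_cent1.
  by rewrite (subsetP _ _ Ox) // centsC subsetIr.
(* A nontrivial normal subgroup of a nilpotent group meets its center nontrivially. *)
have MO1 : M :&: 'O_p(G) = 1.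
  apply: contra_eq MZ1 => ntMO.
  have := meet_center_nil (pgroup_nil (pcore_pgroup p G)) _ ntMO.
  rewrite -setIA (setIidPr (center_sub _)); apply.
  exact: normalS (subsetIr _ _) (pcore_sub _ _) (normalI nsMG (pcore_normal _ _)).
(* [[~ x, m]] lies in [M], which [x] normalizes, and in the normal subgroup ['O_p(G)]. *)
rewrite sub_cent1; apply/centP=> m Mm; apply/commgP/eqP/set1gP.
rewrite -MO1 inE; apply/andP; split.
  by rewrite commgEr groupMr // memJ_norm ?groupV.
rewrite commgEl groupMl ?groupV // memJ_norm //.
by rewrite (subsetP (normal_norm (pcore_normal p G))) ?(subsetP sMG).
Qed.

End PrimePowerClass.

(** * Translations and inverses in an automorphic loop *)

Section AutomorphicLoop.
Variables (T : finType) (op : T -> T -> T) (e : T).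
Hypotheses (loopT : is_loop op e) (autoT : automorphic op e).

Let mul1x x : op e x = x. Proof. by have [] := loopT. Qed.
Let mulx1 x : op x e = x. Proof. by have [_ []] := loopT. Qed.

Lemma loop_mulI a : injective (op a).
Proof.
move=> x y exy; have [_ [_ [/(_ a (op a y))[z [_ zU]] _]]] := loopT.
by rewrite -(zU x exy) (zU y).
Qed.

Lemma loop_Imul a : injective (op^~ a).
Proof.
move=> x y exy; have [_ [_ [_ /(_ a (op y a))[z [_ zU]]]]] := loopT.
by rewrite -(zU x exy) (zU y).
Qed.

Definition lperm a : {perm T} := perm (@loop_mulI a).
Definition rperm a : {perm T} := perm (@loop_Imul a).

Let lpermE a x : lperm a x = op a x. Proof. exact: permE. Qed.
Let rpermE a x : rperm a x = op x a. Proof. exact: permE. Qed.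

Let M := [group of Mlt op].

Lemma lperm_Mlt a : lperm a \in M.
Proof.
apply/mem_gen/setUP; left; rewrite inE; apply/existsP; exists a.
by apply/forallP=> x; rewrite lpermE.
Qed.

Lemma rperm_Mlt a : rperm a \in M.
Proof.
apply/mem_gen/setUP; right; rewrite inE; apply/existsP; exists a.
by apply/forallP=> x; rewrite rpermE.
Qed.

Lemma inner_autm (h : {perm T}) x y :
  h \in M -> h e = e -> h (op x y) = op (h x) (h y).
Proof. by move=> Mh he; apply: autoT; rewrite inE Mh he /=. Qed.

Definition linv x := (lperm x)^-1 e.

Lemma loop_mulxV x : op x (linv x) = e.
Proof. by rewrite -lpermE permKV. Qed.

(* The inner mapping [y |-> x \ (y x)] fixes [x], hence its right inverse. *)
Lemma loop_mulVx x : op (linv x) x = e.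
Proof.
pose t := rperm x * (lperm x)^-1.
have tE y : op x (t y) = op y x by rewrite -lpermE permM permKV rpermE.
have t1 : t e = e by apply: (@loop_mulI x); rewrite tE mul1x mulx1.
have tx : t x = x by apply: (@loop_mulI x); rewrite tE.
have Mt : t \in M by rewrite groupM ?groupV ?lperm_Mlt ?rperm_Mlt.
suff tV : t (linv x) = linv x by rewrite -tE tV loop_mulxV.
by apply: (@loop_mulI x); rewrite loop_mulxV -{1}tx -inner_autm // loop_mulxV.
Qed.

Lemma linv_unique x y : op x y = e -> y = linv x.
Proof. by move=> exy; apply: (@loop_mulI x); rewrite loop_mulxV. Qed.

Lemma linvK : involutive linv.
Proof. by move=> x; rewrite -(linv_unique (loop_mulVx x)). Qed.

Lemma linv1 : linv e = e.
Proof. by rewrite -(@linv_unique e e) ?mul1x. Qed.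

Lemma inner_linv (h : {perm T}) x : h \in M -> h e = e -> h (linv x) = linv (h x).
Proof. by move=> Mh he; apply: linv_unique; rewrite -inner_autm // loop_mulxV. Qed.

(* The inner mapping [z |-> x (z x^-1)] fixes [x], so it commutes with left
translation by [x]. *)
Lemma mulV_flexible x z : op (op x z) (linv x) = op x (op z (linv x)).
Proof.
pose h := rperm (linv x) * lperm x.
have hE y : h y = op x (op y (linv x)) by rewrite permM rpermE lpermE.
have Mh : h \in M by rewrite groupM ?lperm_Mlt ?rperm_Mlt.
have h1 : h e = e by rewrite hE mul1x loop_mulxV.
have hx : h x = x by rewrite hE loop_mulxV mulx1.
by apply: (@loop_mulI x); rewrite -!hE inner_autm // hx.
Qed.

Lemma linvM u v : linv (op u v) = op (linv v) (linv u).
Proof.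
pose b := linv v; pose a := (lperm u)^-1 b.
have ua : op u a = b by rewrite -lpermE permKV.
(* As [linv b = v], the inner mapping [h] sends [linv a] to [op u v], so it sends [a] to the inverse
   of [op u v]. *)
pose h := lperm a * lperm u * rperm (linv b).
have hE z : h z = op (op u (op a z)) (linv b) by rewrite !permM !lpermE rpermE.
have Mh : h \in M by rewrite !groupM ?lperm_Mlt ?rperm_Mlt.
have h1 : h e = e by rewrite hE mulx1 ua loop_mulxV.
have hVa : linv (op u v) = h a.
  rewrite -[a in RHS]linvK inner_linv //.
  by rewrite hE loop_mulxV mulx1 linvK.
pose l := lperm a * lperm u * (lperm b)^-1.
have lE z : op b (l z) = op u (op a z).
  by rewrite -lpermE !permM permKV !lpermE.
have Ml : l \in M by rewrite !groupM ?groupV ?lperm_Mlt.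
have l1 : l e = e by apply: (@loop_mulI b); rewrite lE !mulx1.
have lVu : l (linv u) = linv u.
  by apply: (@loop_mulI b); rewrite lE -mulV_flexible ua.
(* Since [l c = linv b], flexibility turns [h a] into [op b (op (l a) (l c))], that is
   [op b (l (linv u))]. *)
pose c := (lperm a)^-1 (linv u).
have ac : op a c = linv u by rewrite -lpermE permKV.
have lc : l c = linv b.
  by apply: (@loop_mulI b); rewrite lE ac !loop_mulxV.
by rewrite hVa hE -lE mulV_flexible -lc -inner_autm // ac lVu.
Qed.

(** * Inversion as a permutation, its conjugates and the quotient loop *)

Definition jperm : {perm T} := perm (can_inj linvK).

Let jpermE x : jperm x = linv x. Proof. exact: permE. Qed.

Lemma lpermJ x : lperm x ^ jperm = rperm (linv x).
Proof.
apply/permP=> y; rewrite -[y](permKV jperm) permJ; set z := (jperm^-1 y).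
by rewrite !jpermE lpermE rpermE linvM.
Qed.

Lemma jperm_sqr : jperm * jperm = 1.
Proof. by apply/permP=> x; rewrite permM !jpermE linvK perm1. Qed.

Lemma jperm_norm : jperm \in 'N(M).
Proof.
have JV : jperm^-1 = jperm by apply/eqP; rewrite eq_invg_mul jperm_sqr.
rewrite inE /= /Mlt -genJ gen_subG; apply/subsetP=> _ /imsetP[g gLR ->].
case/setUP: gLR; rewrite inE => /existsP[a /forallP ga].
  rewrite (_ : g = lperm a) ?lpermJ ?rperm_Mlt //.
  by apply/permP=> x; rewrite lpermE (eqP (ga x)).
rewrite (_ : g = rperm a); last first.
  by apply/permP=> x; rewrite rpermE (eqP (ga x)).
by rewrite -[a]linvK -lpermJ -conjgM jperm_sqr conjg1 lperm_Mlt.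
Qed.

Lemma jperm_cent_inner (h : {perm T}) : h \in M -> h e = e -> jperm ^ h = jperm.
Proof.
move=> Mh h1; apply/conjg_fixP/commgP.
by apply/permP=> x; rewrite !permM !jpermE inner_linv.
Qed.

Definition jconj x := jperm ^ lperm x.

(** [lperm x * g] and [lperm (g x)] both send [e] to [g x], so they differ by an inner mapping,
    which centralizes [jperm]. *)
Lemma jconjM (g : {perm T}) x : g \in M -> jconj (g x) = jconj x ^ g.
Proof.
move=> Mg; pose h := lperm x * g * (lperm (g x))^-1.
have Mh : h \in M by rewrite !groupM ?groupV ?lperm_Mlt.
have h1 : h e = e.
  by rewrite !permM lpermE mulx1; apply: (canLR (permK _)); rewrite lpermE mulx1.
rewrite /jconj -{1}(jperm_cent_inner Mh h1) -!conjgM.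
by rewrite /h mulgKV.
Qed.

Lemma jconj1 : jconj e = jperm.
Proof. by apply: jperm_cent_inner; rewrite ?lperm_Mlt // lpermE mul1x. Qed.

Lemma jconj_mul_congr x x' y y' :
  jconj x = jconj x' -> jconj y = jconj y' -> jconj (op x y) = jconj (op x' y').
Proof.
move=> exx' eyy'; rewrite -lpermE jconjM ?lperm_Mlt // eyy' -jconjM ?lperm_Mlt //.
by rewrite lpermE -!rpermE !jconjM ?rperm_Mlt // exx'.
Qed.

(** The quotient of the loop by equality of [jconj], realized as the image of [jconj]. *)
Definition jclass := {q : {perm T} | q \in [set jconj x | x : T]}.

Definition to_jclass x : jclass := exist _ (jconj x) (imset_f jconj (erefl : x \in T)).

Fact to_jclass_surj (q : jclass) : exists x, to_jclass x == q.
Proof. by case: q => q q_in; case/imsetP: (q_in) => x _ qE; exists x; apply/eqP/val_inj. Qed.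

Definition jclass_op (p q : jclass) : jclass :=
  to_jclass (op (xchoose (to_jclass_surj p)) (xchoose (to_jclass_surj q))).

Lemma to_jclassM : loop_hom op jclass_op to_jclass.
Proof.
move=> x y; apply/val_inj/jconj_mul_congr.
  by case: (xchooseP (to_jclass_surj (to_jclass x))) => /eqP/(congr1 val).
by case: (xchooseP (to_jclass_surj (to_jclass y))) => /eqP/(congr1 val).
Qed.

Lemma jclass_loop : is_loop jclass_op (to_jclass e).
Proof.
have surj q : exists x, q = to_jclass x.
  by have [x /eqP <-] := to_jclass_surj q; exists x.
split; first by move=> q; have [x ->] := surj q; rewrite -to_jclassM mul1x.
split; first by move=> q; have [x ->] := surj q; rewrite -to_jclassM mulx1.
split=> p q; have [[a ->] [b ->]] := (surj p, surj q).
  exists (to_jclass ((lperm a)^-1 b)); split.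
    by rewrite -to_jclassM -lpermE permKV.
  (* Division is unique because [jconj] is equivariant under inverse translations too. *)
  move=> r; have [x ->] := surj r; rewrite -to_jclassM => /(congr1 val) /= ab.
  by apply: val_inj; rewrite /= jconjM ?groupV ?lperm_Mlt // -ab -lpermE
    jconjM ?lperm_Mlt // conjgK.
exists (to_jclass ((rperm a)^-1 b)); split.
  by rewrite -to_jclassM -rpermE permKV.
move=> r; have [x ->] := surj r; rewrite -to_jclassM => /(congr1 val) /= ab.
by apply: val_inj; rewrite /= jconjM ?groupV ?rperm_Mlt // -ab -rpermE
  jconjM ?rperm_Mlt // conjgK.
Qed.

(** * Consequences of simplicity *)

Lemma simple_jperm_cent : simple_loop op e -> 2.-nat #|T| -> M \subset 'C[jperm].
Proof.
move=> simpleT T2.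
have [cJ | cJ] := simpleT _ _ _ _ jclass_loop to_jclassM.
  rewrite sub_cent1; apply/centP=> g Mg; apply/commgP/conjg_fixP.
  by rewrite -jconj1 -jconjM //; exact: (congr1 val (cJ (g e))).
have fixJ (g : {perm T}) : g \in M -> jperm ^ g = jperm -> g e = e.
  by move=> Mg gJ; apply/cJ/val_inj; rewrite /= jconjM // jconj1.
have clJ : jperm ^: M = [set jconj x | x : T].
  apply/setP=> q; apply/imsetP/imsetP => [[g Mg ->] | [x _ ->]].
    by exists (g e); rewrite // jconjM // jconj1.
  by exists (lperm x); rewrite ?lperm_Mlt.
apply: (@prime_power_class_cent _ 2) => // [||| H /andP[sHM nHM] cH].
- exact: jperm_norm.
- rewrite /p_elt; apply: (@pnat_dvd _ 2) => //.
  by rewrite order_dvdn expgS expg1 jperm_sqr.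
(* If [x] and [y] give equal conjugates, [lperm y * (lperm x)^-1] centralizes [jperm], hence fixes
   [e]. *)
- rewrite clJ card_imset // => x y exy.
  have: (lperm y * (lperm x)^-1) e = e.
    apply: fixJ; first by rewrite groupM ?groupV ?lperm_Mlt.
    by rewrite conjgM -/(jconj y) -exy conjgK.
  by rewrite permM lpermE mulx1 => /(canRL (permKV _)); rewrite lpermE mulx1.
(* The conjugates of [h] by translations stay in [H] and so fix [e]; thus [h] fixes every point. *)
apply/trivgP/subsetP=> h Hh; apply/set1gP/permP=> x.
have Hhx : h ^ (lperm x)^-1 \in H.
  by rewrite memJ_norm // groupV (subsetP nHM) ?lperm_Mlt.
have: (h ^ (lperm x)^-1) e = e.
  apply: fixJ; first exact: subsetP sHM _ Hhx.
  by apply/conjg_fixP/commgP/commute_sym/cent1P/(subsetP cH).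
rewrite conjgE invgK !permM lpermE mulx1 => /(canRL (permKV _)).
by rewrite lpermE mulx1 perm1.
Qed.

Lemma simple_automorphic_2loop : simple_loop op e -> 2.-nat #|T| ->
  (forall x y, op x y = op y x) /\ (forall x, op x x = e).
Proof.
move=> simpleT T2.
have linv_id x : linv x = x.
  (* Both composites of [jperm] and [lperm x] are evaluated at [e]. *)
  have /cent1P/(congr1 (fun g : {perm T} => g e)) :=
    subsetP (simple_jperm_cent simpleT T2) _ (lperm_Mlt x).
  by rewrite !permM !jpermE !lpermE linv1 mulx1.
split=> [x y | x]; last by rewrite -{2}[x]linv_id loop_mulxV.
by rewrite -[LHS]linv_id linvM !linv_id.
Qed.

End AutomorphicLoop.

Theorem theorem3p7 (T : finType) (op : T -> T -> T) (e : T) :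
  two_loop op e -> automorphic op e -> simple_loop op e ->
  (forall x y, op x y = op y x) /\ (forall x, op x x = e).
Proof.
move=> [loopT [m [_ cardT]]] autoT simpleT.
by apply: (simple_automorphic_2loop loopT autoT simpleT); rewrite cardT pnatX.
Qed.
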